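(* Let $A=\{0,1\}$ and let $(A^{\mathbb{Z}},F)$ be a one-dimensional cellular automaton. If there exists a nonempty set $W\subset A^{\ell}$ of words of some length $\ell\geq 1$ that is visibly blocking for $F$, then $(A^{\mathbb{Z}},F)$ is not controllable.
   Context: A cellular automaton of radius $r\ge 1$ is given by a local rule $f:A^{2r+1}\to A$ and $F(s)_i=f(s_{i-r},\dots,s_{i+r})$. Visibly blocking: a set of words $W\subset A^\ell$ (possibly all of $A^\ell$) is visibly blocking for $F$ if (1) for all $s\in A^{\mathbb{Z}}$, $s_{[0,\ell-1]}\in W$ if and only if $F(s)_{[0,\ell-1]}\in W$; and (2) for all $s,s'\in A^{\mathbb{Z}}$ with $s_{[0,\ell-1]}\in W$: if $s_i=s'_i$ for all $i\ge 0$, then $F^t(s)_i=F^t(s')_i$ for all $t\in\mathbb{N}$ and $i\ge\ell$; and if $s_i=s'_i$ for all $i\le \ell-1$, then $F^t(s)_i=F^t(s')_i$ for all $t\in\mathbb{N}$ and $i<0$. Controllability: the controlled CA is specified by the CA together with a subdomain $\Omega_{c_p}$ of the cellular space $\mathbb{Z}$ formed by $p$ cells, on which controls are applied, and a local control function $g:\mathbb{R}\to A$. A control $U$ assigns to each time $t$ and each $c\in\Omega_{c_p}$ a value $U_t(c)\in\mathbb{R}$ (boundedly), and acts through $GU_t(c)=g(U_t(c))$ for $c\in\Omega_{c_p}$ and $GU_t(c)=0$ elsewhere. The controlled evolution is $s^{t+1}=F(s^t+GU_t)$, with cellwise addition in $A$ (modulo 2). A configuration $s^d\in A^{\mathbb{Z}}$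 is reachable from $s\in A^{\mathbb{Z}}$ at time $T$ if there are a sequence of controls $U_t$ and configurations $s=s^0,s^1,\dots,s^T=s^d$ with $s^{t+1}=F(s^t+GU_t)$ for each $0\le t<T$. The CA is controllable if every configuration $s'\in A^{\mathbb{Z}}$ is reachable starting from any other configuration $s\in A^{\mathbb{Z}}$ at some time $T$. *)

(* Defs.v *)
From mathcomp Require Import all_boot all_order all_algebra finmap reals.

Set Implicit Arguments.
Unset Strict Implicit.
Unset Printing Implicit Defensive.

Import Order.TTheory GRing.Theory Num.Theory.
Local Open Scope ring_scope.

(* The alphabet {0, 1} is 'F_2, whose addition is addition modulo 2. *)
Definition config := int -> 'F_2.

(* The word s_a s_(a+1) ... s_(a+n-1). *)
Definition word_at (s : config) (a : int) (n : nat) : n.-tuple 'F_2 :=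
  [tuple s (a + j%:Z) | j < n].

Definition local_rule (r : nat) := (2 * r + 1).-tuple 'F_2 -> 'F_2.

Definition ca (r : nat) (f : local_rule r) (s : config) : config :=
  fun i => f (word_at s (i - r%:Z) (2 * r + 1)).

Definition visibly_blocking (F : config -> config) (l : nat)
    (W : {set l.-tuple 'F_2}) : Prop :=
  (forall s : config, word_at s 0 l \in W <-> word_at (F s) 0 l \in W) /\
  (forall s s' : config, word_at s 0 l \in W ->
     ((forall i : int, 0 <= i -> s i = s' i) ->
      forall (t : nat) (i : int), l%:Z <= i -> iter t F s i = iter t F s' i) /\
     ((forall i : int, i <= l%:Z - 1 -> s i = s' i) ->
      forall (t : nat) (i : int), i < 0 -> iter t F s i = iter t F s' i)).

Section Control.
Variables (R : realType) (F : config -> config).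
Variables (Omega : {fset int}) (g : R -> 'F_2).

Definition bounded_control (U : nat -> Omega -> R) : Prop :=
  exists M : R, forall (t : nat) (c : Omega), `|U t c| <= M.

(* [insub c] is [Some c] viewed in the finite type Omega if c \in Omega, and
   [None] otherwise. *)
Definition control_action (u : Omega -> R) : config :=
  fun c => if insub c is Some c' then g (u c') else 0.

Definition reachable_at (T : nat) (s sd : config) : Prop :=
  exists (U : nat -> Omega -> R) (x : nat -> config),
    [/\ bounded_control U, x 0%N = s, x T = sd &
        forall t : nat, (t < T)%N -> x t.+1 = F (x t \+ control_action (U t))].

Definition controllable : Prop :=
  forall s s' : config, s <> s' -> exists T : nat, reachable_at T s s'.

End Control.

(* Main.v *)
Require Import Defs.
From mathcomp Require Import all_boot all_order all_algebra finmap reals.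
From mathcomp Require Import boolp.

Set Implicit Arguments.
Unset Strict Implicit.
Unset Printing Implicit Defensive.

Import Order.TTheory GRing.Theory Num.Theory.
Local Open Scope ring_scope.

(** Put a word of W to the right of every controlled cell. Controls never touch
that word, and F keeps it in W, so everything to its right evolves as under the
uncontrolled F, whatever the controls are. A target that differs at its T-th
cell beyond the word from the T-th uncontrolled iterate, for every T, is
therefore unreachable. *)

(** Visible blocking concerns the word at cell 0, so configurations are translated to bring the
    controlled cells to negative positions. *)
Definition shift (a : int) (s : config) : config := fun i => s (i + a).

Lemma ca_shift (r : nat) (f : local_rule r) (a : int) (s : config) :
  ca f (shift a s) = shift a (ca f s).
Proof.
apply: funext => i; rewrite /ca /shift; congr (f _).
by apply: eq_mktuple => j; congr (s _); rewrite addrAC [i - _ + a]addrAC.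
Qed.

Lemma eq_word_at (s s' : config) (a : int) (n : nat) :
  (forall i, a <= i -> s i = s' i) -> word_at s a n = word_at s' a n.
Proof. by move=> eqs; apply: eq_mktuple => j; apply: eqs; rewrite lerDl. Qed.

(* The equality is stated for all further iterates [k], not just [k = 0]: the
   cells inside the word may feel the perturbation, so the configurations at
   time [t] need not agree from cell 0 on, and an induction with [k = 0] alone
   does not go through. *)
Lemma perturbed_orbit (F : config -> config) (l : nat) (W : {set l.-tuple 'F_2})
    (x u : nat -> config) (T : nat) :
  visibly_blocking F W ->
  (forall t, (t < T)%N -> x t.+1 = F (x t \+ u t)) ->
  (forall t i, 0 <= i -> u t i = 0) ->
  word_at (x 0%N) 0 l \in W ->
  forall t, (t <= T)%N -> word_at (x t) 0 l \in W /\
    forall k i, l%:Z <= i -> iter k F (x t) i = iter (k + t) F (x 0%N) i.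
Proof.
move=> [invW blockW] stepx u0 Wx0; elim=> [|t IHt] ltT.
  by split=> // k i _; rewrite addn0.
have [Wxt eqxt] := IHt (ltnW ltT).
have eqxu i : 0 <= i -> x t i = (x t \+ u t) i.
  by move=> i0; rewrite /= u0 // addr0.
rewrite (stepx _ ltT); split.
  by apply/(invW _).1; rewrite -(eq_word_at l eqxu).
(* [x t] and [x t \+ u t] agree from cell 0 on, so blocking makes their [k.+1]-th iterates agree
   from cell [l] on. *)
move=> k i li; rewrite -iterSr addnS -addSn -eqxt //.
by rewrite ((blockW _ _ Wxt).1 eqxu).
Qed.

Lemma fset_int_ubound (Omega : {fset int}) :
  exists a : int, forall c, c \in Omega -> c < a.
Proof.
exists (\max_(c <- Omega) `|c|%N).+1%:Z => c cO.
apply: (le_lt_trans (ler_norm c)); rewrite -abszE ltz_nat ltnS.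
exact: (leq_bigmax_seq (F := absz)).
Qed.

Theorem proposition4p11 (r : nat) (hr : (1 <= r)%N) (f : local_rule r)
    (hW : exists (l : nat) (W : {set l.-tuple 'F_2}),
        [/\ (1 <= l)%N, W != set0 & visibly_blocking (ca f) W])
    (R : realType) (p : nat) (Omega : {fset int})
    (hOmega : #|` Omega| = p) (g : R -> 'F_2) :
  ~ controllable (ca f) Omega g.
Proof.
case: hW => l [W [_ /set0Pn[w Ww] hvb]] ctrl.
have [a ltOa] := fset_int_ubound Omega.
(* Cells 0 to [l - 1] spell [w]; the values elsewhere are arbitrary. *)
pose y : config := fun i => nth 0 w `|i|%N.
(* Diagonal choice: the distance to cell [l] serves as the time, so a single [z] defeats every
   [T]. *)
pose z : config := fun i => iter `|i - l%:Z|%N (ca f) y i + 1.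
have zE T : z (l%:Z + T%:Z) = iter T (ca f) y (l%:Z + T%:Z) + 1.
  by rewrite /z addrAC subrr add0r.
have neq1 (b : 'F_2) : b <> b + 1.
  by move/eqP; rewrite eq_sym -subr_eq0 addrAC subrr add0r oner_eq0.
have shiftNK s : shift a (shift (- a) s) = s.
  by apply: funext => i; rewrite /shift addrK.
have [|T [U [x [_ x0 xT stepx]]]] := ctrl (shift (- a) y) (shift (- a) z).
  (* Controllability asks for distinct configurations: these differ at cell [l], the diagonal entry
     for time 0. *)
  move/(congr1 (fun s => shift a s (l%:Z + 0%:Z))); rewrite !shiftNK zE.
  exact: neq1.
pose u t := shift a (control_action g (U t)).
have u0 t i : 0 <= i -> u t i = 0.
  move=> i0; rewrite /u /shift /control_action; case: insubP => // c + _.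
  by move/ltOa; rewrite ltNge lerDr i0.
have stepy t : (t < T)%N ->
    shift a (x t.+1) = ca f (shift a (x t) \+ u t).
  by move=> /stepx ->; rewrite -ca_shift.
have Wy : word_at (shift a (x 0%N)) 0 l \in W.
  suff -> : word_at (shift a (x 0%N)) 0 l = w by [].
  apply: eq_from_tnth => j.
  by rewrite x0 shiftNK tnth_mktuple add0r (tnth_nth 0).
have [_ /(_ 0%N (l%:Z + T%:Z))] :=
  perturbed_orbit (x := fun t => shift a (x t)) hvb stepy u0 Wy (leqnn T).
rewrite lerDl /= xT x0 !shiftNK zE => /(_ isT) /esym.
exact: neq1.
Qed.
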